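(* In the decorated logic for states $L_{sta}$, if every non-empty type is inhabited and $V$ is non-empty, then the theory of states $T_{sta}$ is Hilbert-Post complete with respect to the pure sublogic $L_{sta}^{(0)}$ of $L_{sta}$.
   Context: Monadic equational logic with constants $L_{eqn,1}$: types and terms generated by a signature of unary operations, terms being composable paths (with identities); a unit type $\mathbb{1}$ with a term $\langle\,\rangle_X:X\to\mathbb{1}$ for each $X$. Formulas are pairs of parallel terms. Rules: $\equiv$ is an equivalence relation; (subs) from $v_1\equiv v_2:Y\to Z$ and $u:X\to Y$ infer $v_1\circ u\equiv v_2\circ u$; (repl) from $v_1\equiv v_2:X\to Y$ and $w:Y\to Z$ infer $w\circ v_1\equiv w\circ v_2$; (unit) every $f:X\to\mathbb{1}$ satisfies $f\equiv\langle\,\rangle_X$. Decorated logic for states $L_{sta}$: pure part a logic $L_{sta}^{(0)}$ extending $L_{eqn,1}$ with a distinguished type $V$ (pure terms, decoration $(0)$). Terms of $L_{sta}$ are composites of pure terms, $\mathtt{lookup}:\mathbb{1}\to V$ (decoration $(1)$) and $\mathtt{update}:V\to\mathbb{1}$ (decoration $(2)$); decoration of a composite is the maximum; accessors are terms of decoration at most $(1)$; all terms are modifiers. Formulas: strong equations $f\equiv g$ and weak equations $f\sim g$ between parallel terms. Rules: for $\equiv$: equivalence, (subs), (repl) for all decorations; for $\sim$: equivalence and (subs) for all decorations, (repl) only when the outer term is pure; (unit$_\sim$) every $f:X\to\mathbb{1}$ satisfies $f\sim\langle\,\rangle_X$; $f\equiv g$ implies $f\sim g$; (ax) $\mathtt{lookup}\circ\mathtt{update}\sim\mathrm{id}_V$;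 (eq$_1$) $f_1\sim f_2$ with $f_1,f_2$ accessors implies $f_1\equiv f_2$; (eq$_2$) for $f_1,f_2:X\to Y$, $f_1\sim f_2$ and $\langle\,\rangle_Y\circ f_1\equiv\langle\,\rangle_Y\circ f_2$ imply $f_1\equiv f_2$; (eq$_3$) for $f_1,f_2:X\to\mathbb{1}$, $\mathtt{lookup}\circ f_1\sim\mathtt{lookup}\circ f_2$ implies $f_1\equiv f_2$; plus the rules of $L_{sta}^{(0)}$ for pure terms. A theory is a set of formulas closed under the rules. $T_{sta}$ is the theory of $L_{sta}$ generated by a fixed theory $T^{(0)}$ of $L_{sta}^{(0)}$. A type $X$ is inhabited if there is a pure term $k_X:\mathbb{1}\to X$. A type $\mathbb{0}$ is empty if for each type $Y$ there is a pure term $[\,]_Y:\mathbb{0}\to Y$ and every term $f:\mathbb{0}\to Y$ satisfies $f\equiv[\,]_Y$; non-empty means not empty. For a theory $T_0$ of $L_{sta}^{(0)}$, $F(T_0)$ is the theory of $L_{sta}$ it generates; $T+T'$ is the theory generated by $T\cup T'$. A theory $T$ of $L_{sta}$ is Hilbert-Post complete with respect to $L_{sta}^{(0)}$ if it is consistent (does not contain all formulas of $L_{sta}$) and every theory $T'\supseteq T$ of $L_{sta}$ satisfies $T'=T+F(T'_0)$ for some theory $T'_0$ of $L_{sta}^{(0)}$. The logic is interpreted soundly in sets: for a fixed set $S$ of states, pure terms $X\to Y$ are functions $X\to Y$, accessors functions $S\times X\to Y$, modifiers functions $S\times X\to S\times Y$; $\mathtt{lookup}:S\to V$, $\mathtt{update}:S\times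 V\to S$; $\equiv$ is equality of functions and $\sim$ equality of the returned values.
   Formalization: The fixed pure theory T^(0) is additionally assumed consistent (it does not contain all pure formulas); otherwise, with V inhabited, T_sta would contain every formula and could not be Hilbert-Post complete. *)

(* Defs.v *)
From Stdlib Require List.
From mathcomp Require Import all_boot.
From mathcomp Require Import boolp classical_sets.

Set Implicit Arguments.
Unset Strict Implicit.
Unset Printing Implicit Defensive.

Local Open Scope classical_set_scope.

Section Paths.
Context {O : Type} {G : O -> O -> Type}.

(* Composable paths of generators.  [Cons g f] is "g after f", so that
   composition is concatenation and is associative and unital up to Leibniz
   equality: no equational rule is needed for the category axioms. *)
Inductive path (X : O) : O -> Type :=
| Id : path X X
| Cons Y Z : G Y Z -> path X Y -> path X Z.

Fixpoint comp X Y Z (g : path Y Z) (f : path X Y) : path X Z :=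
  match g with
  | Id => f
  | Cons _ _ a g' => Cons a (comp g' f)
  end.

Definition gen X Y (g : G X Y) : path X Y := Cons g (Id X).

Lemma compf1 X Y (f : path X Y) : comp f (Id X) = f.
Proof. by elim: f => //= Y1 Z a f ->. Qed.

Lemma compA X Y Z W (h : path Z W) (g : path Y Z) (f : path X Y) :
  comp h (comp g f) = comp (comp h g) f.
Proof. by elim: h g => //= Y1 Z1 a h IH g; rewrite IH. Qed.

End Paths.
Arguments path {O} G X _.
Arguments Id {O G} X.

Notation "g '\c' f" := (comp g f) (at level 40, left associativity).

Record signature := Signature {
  type :> Type;
  unit_type : type;
  value_type : type;
  operation : type -> type -> Type
}.
Arguments unit_type {s}.
Arguments value_type {s}.
Notation "'\1'" := unit_type.
Notation "'\V'" := value_type.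

Inductive pure_gen (S : signature) : S -> S -> Type :=
| Bang X : pure_gen X \1
| Op X Y : operation X Y -> pure_gen X Y.

Definition pterm (S : signature) (X Y : S) := path (@pure_gen S) X Y.

Definition pbang (S : signature) (X : S) : pterm X \1 := gen (Bang X).

Inductive pformula (S : signature) : Type :=
| PEq (X Y : S) of pterm X Y & pterm X Y.

(* An arbitrary logic extending monadic equational logic with constants: the
   additional term formers are entries of [operation], the additional rules are
   given by [extra_rule premises conclusion]. *)
Record pure_logic := PureLogic {
  sig :> signature;
  extra_rule : seq (pformula sig) -> pformula sig -> Prop
}.

Record ptheory (L : pure_logic) (T : set (pformula L)) : Prop := PTheory {
  pth_refl : forall (X Y : L) (f : pterm X Y), T (PEq f f);
  pth_sym : forall (X Y : L) (f g : pterm X Y), T (PEq f g) -> T (PEq g f);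
  pth_trans : forall (X Y : L) (f g h : pterm X Y),
    T (PEq f g) -> T (PEq g h) -> T (PEq f h);
  pth_subs : forall (X Y Z : L) (u : pterm X Y) (v1 v2 : pterm Y Z),
    T (PEq v1 v2) -> T (PEq (v1 \c u) (v2 \c u));
  pth_repl : forall (X Y Z : L) (v1 v2 : pterm X Y) (w : pterm Y Z),
    T (PEq v1 v2) -> T (PEq (w \c v1) (w \c v2));
  pth_unit : forall (X : L) (f : pterm X \1), T (PEq f (pbang X));
  pth_extra : forall (ps : seq (pformula L)) (c : pformula L),
    extra_rule ps c -> List.Forall T ps -> T c
}.

Inductive sta_gen (S : signature) : S -> S -> Type :=
| Pure X Y : pure_gen X Y -> sta_gen X Y
| Lookup : sta_gen \1 \V
| Update : sta_gen \V \1.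
Arguments Lookup {S}.
Arguments Update {S}.

Definition term (S : signature) (X Y : S) := path (@sta_gen S) X Y.

Definition lookup {S : signature} : term (\1 : S) \V := gen Lookup.
Definition update {S : signature} : term (\V : S) \1 := gen Update.

Fixpoint pure (S : signature) (X Y : S) (f : pterm X Y) : term X Y :=
  match f with
  | Id => Id X
  | Cons _ _ a f' => Cons (Pure a) (pure f')
  end.

Definition bang (S : signature) (X : S) : term X \1 := pure (pbang X).

Definition gen_decoration (S : signature) (X Y : S) (g : sta_gen X Y) : nat :=
  match g with Pure _ _ _ => 0 | Lookup => 1 | Update => 2 end.

Fixpoint decoration (S : signature) (X Y : S) (f : term X Y) : nat :=
  match f with
  | Id => 0
  | Cons _ _ a f' => maxn (gen_decoration a) (decoration f')
  end.

Definition accessor (S : signature) (X Y : S) (f : term X Y) : Prop :=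
  decoration f <= 1.

Lemma decoration_comp (S : signature) (X Y Z : S) (g : term Y Z)
  (f : term X Y) : decoration (g \c f) = maxn (decoration g) (decoration f).
Proof. by elim: g f => [|? ? ? g IH] f /=; rewrite ?max0n // IH maxnA. Qed.

Lemma pure_comp (S : signature) (X Y Z : S) (g : pterm Y Z) (f : pterm X Y) :
  pure (g \c f) = pure g \c pure f.
Proof. by elim: g f => [|? ? ? g IH] f //=; rewrite IH. Qed.

(* The pure terms are exactly the terms of decoration (0). *)
Lemma decoration0P (S : signature) (X Y : S) (f : term X Y) :
  decoration f = 0 <-> exists p : pterm X Y, f = pure p.
Proof.
split; last by case=> p ->; elim: p => //= ? ? a p ->.
elim: f => [_|Y1 Z a f IH /= /eqP]; first by exists (Id X).
rewrite -leqn0 geq_max !leqn0 => /andP[a0 /eqP /IH[p ->]].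
by case: a p a0 {IH} => [A B b|//|//] p _; exists (Cons b p).
Qed.

Inductive formula (S : signature) : Type :=
| Strong (X Y : S) of term X Y & term X Y
| Weak (X Y : S) of term X Y & term X Y.

Definition pure_formula (S : signature) (e : pformula S) : formula S :=
  match e with PEq _ _ f g => Strong (pure f) (pure g) end.

Record theory (L : pure_logic) (T : set (formula L)) : Prop := Theory {
  th_refl : forall (X Y : L) (f : term X Y), T (Strong f f);
  th_sym : forall (X Y : L) (f g : term X Y),
    T (Strong f g) -> T (Strong g f);
  th_trans : forall (X Y : L) (f g h : term X Y),
    T (Strong f g) -> T (Strong g h) -> T (Strong f h);
  th_subs : forall (X Y Z : L) (u : term X Y) (v1 v2 : term Y Z),
    T (Strong v1 v2) -> T (Strong (v1 \c u) (v2 \c u));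
  th_repl : forall (X Y Z : L) (v1 v2 : term X Y) (w : term Y Z),
    T (Strong v1 v2) -> T (Strong (w \c v1) (w \c v2));
  th_wrefl : forall (X Y : L) (f : term X Y), T (Weak f f);
  th_wsym : forall (X Y : L) (f g : term X Y), T (Weak f g) -> T (Weak g f);
  th_wtrans : forall (X Y : L) (f g h : term X Y),
    T (Weak f g) -> T (Weak g h) -> T (Weak f h);
  th_wsubs : forall (X Y Z : L) (u : term X Y) (v1 v2 : term Y Z),
    T (Weak v1 v2) -> T (Weak (v1 \c u) (v2 \c u));
  th_wrepl : forall (X Y Z : L) (v1 v2 : term X Y) (w : pterm Y Z),
    T (Weak v1 v2) -> T (Weak (pure w \c v1) (pure w \c v2));
  th_wunit : forall (X : L) (f : term X \1), T (Weak f (bang X));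
  th_weak : forall (X Y : L) (f g : term X Y),
    T (Strong f g) -> T (Weak f g);
  th_ax : T (Weak (lookup \c update) (Id \V));
  th_eq1 : forall (X Y : L) (f1 f2 : term X Y),
    accessor f1 -> accessor f2 -> T (Weak f1 f2) -> T (Strong f1 f2);
  th_eq2 : forall (X Y : L) (f1 f2 : term X Y),
    T (Weak f1 f2) -> T (Strong (bang Y \c f1) (bang Y \c f2)) ->
    T (Strong f1 f2);
  th_eq3 : forall (X : L) (f1 f2 : term X \1),
    T (Weak (lookup \c f1) (lookup \c f2)) -> T (Strong f1 f2);
  (* closure under the rules of the pure logic, applied to pure terms *)
  th_pure : ptheory (@pure_formula L @^-1` T)
}.

Definition generated (L : pure_logic) (A : set (formula L)) :
  set (formula L) := smallest (@theory L) A.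

Definition F (L : pure_logic) (T0 : set (pformula L)) : set (formula L) :=
  generated (@pure_formula L @` T0).

Definition theory_add (L : pure_logic) (T T' : set (formula L)) :
  set (formula L) := generated (T `|` T').

Definition T_sta (L : pure_logic) (T0 : set (pformula L)) : set (formula L) :=
  F T0.

Definition inhabited_type (L : pure_logic) (X : L) : Prop :=
  inhabited (pterm \1 X).

(* Emptiness is relative to a theory T: the equations [f == [ ]_Y] are
   required to belong to T. *)
Definition empty_type (L : pure_logic) (T : set (formula L)) (X : L) : Prop :=
  forall Y : L, exists i : pterm X Y,
    forall f : term X Y, T (Strong f (pure i)).

Definition consistent (L : pure_logic) (T : set (formula L)) : Prop :=
  T <> setT.

(* If T0 contains every pure formula then [T_sta T0] contains every formula
   (as soon as V is inhabited): [update == bang \V] and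
   [lookup == k_V] become derivable.  Consistency of T0 is thus necessary for
   the consistency of [T_sta T0]. *)
Definition pconsistent (L : pure_logic) (T0 : set (pformula L)) : Prop :=
  T0 <> setT.

Definition hilbert_post_complete (L : pure_logic) (T : set (formula L)) :
  Prop :=
  consistent T /\
  forall T' : set (formula L), theory T' -> T `<=` T' ->
    exists T'0 : set (pformula L), ptheory T'0 /\ T' = theory_add T (F T'0).

(* Main.v *)
Require Import Defs.
From mathcomp Require Import all_boot.
From mathcomp Require Import boolp classical_sets.

(** Completeness: modulo the rules, every term is weakly equal to a pure term
    [u] or to [p \c lookup \c bang X] with [p] pure, and a strong equation
    [f == g] amounts to the weak equations [f ~ g] and
    [lookup \c bang Y \c f ~ lookup \c bang Y \c g].  When the source is
    inhabited, a weak equation between normal forms is equivalent to pure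
    equations: composing with [update] turns [lookup] into an identity; when
    the source is empty it holds already.

    Consistency: for every type [A], read a type [X] as the set of pure terms
    from [A] to [X] modulo the pure theory, with [V] itself as set of states,
    [lookup] as the identity and [update] as the overwriting of the state.  Since
    [V] is inhabited there is always a state, so the pure equations valid for
    all [A] are exactly those of the pure theory. *)

Set Implicit Arguments.
Unset Strict Implicit.
Unset Printing Implicit Defensive.

Local Open Scope classical_set_scope.

(** * Accessors *)

Lemma accessor_pure (S : signature) (X Y : S) (p : pterm X Y) :
  accessor (pure p).
Proof. by rewrite /accessor (proj2 (decoration0P (pure p))) //; exists p. Qed.

Lemma accessor_comp (S : signature) (X Y Z : S) (g : term Y Z) (f : term X Y) :
  accessor g -> accessor f -> accessor (g \c f).
Proof. by rewrite /accessor decoration_comp geq_max => -> ->. Qed.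

(** * Weak normal forms in an arbitrary theory *)

Section Theory.
Variables (L : pure_logic) (T : set (formula L)).
Hypothesis T_th : theory T.

Lemma accessor_bang (X : L) (f : term X \1) :
  accessor f -> T (Strong f (bang X)).
Proof.
by move=> fa; apply: (th_eq1 T_th fa (accessor_pure _)); apply: th_wunit.
Qed.

Lemma bang_unit : T (Strong (bang (\1 : L)) (Id \1)).
Proof. by apply: (th_sym T_th); apply: accessor_bang. Qed.

Lemma bang_comp (X Y : L) (f : term X Y) :
  accessor f -> T (Strong (bang Y \c f) (bang X)).
Proof. by move=> fa; apply/accessor_bang/accessor_comp/fa/accessor_pure. Qed.

(** The composite [bang Y \c v] is an accessor from [\1] to [\1], hence strongly the identity. Here
    [f] may be a modifier, so a value [v] created after an [update] can be discarded. *)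
Lemma bang_comp_unit_source (X Y : L) (f : term X \1) (v : term \1 Y) :
  accessor v -> T (Strong (bang Y \c (v \c f)) f).
Proof.
move=> va; rewrite Defs.compA; apply: (@th_subs _ _ T_th _ _ _ f _ (Id \1)).
exact: th_trans T_th _ _ _ _ _ (bang_comp va) bang_unit.
Qed.

Lemma weak_pure (X Y : L) (u v : pterm X Y) :
  T (Weak (pure u) (pure v)) -> T (Strong (pure u) (pure v)).
Proof. by apply: (th_eq1 T_th); apply: accessor_pure. Qed.

Lemma weak_pure_unit (X Y : L) (w : pterm \1 Y) (f : term X \1) :
  T (Weak (pure w \c f) (pure w \c bang X)).
Proof. by apply/(th_wrepl T_th)/(th_wunit T_th). Qed.

Lemma weak_lookup_update (X : L) (g : term X \V) :
  T (Weak (lookup \c (update \c g)) g).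
Proof. by rewrite Defs.compA; exact: (th_wsubs T_th g (th_ax T_th)). Qed.

Definition read (X Y : L) (p : pterm \V Y) : term X Y :=
  pure p \c (lookup \c bang X).

Variant normal (X Y : L) : term X Y -> Prop :=
| NormalPure (u : pterm X Y) : normal (pure u)
| NormalRead (p : pterm \V Y) : normal (read X p).

Definition normalizable (X Y : L) (f : term X Y) : Prop :=
  exists2 a, normal a & T (Weak f a).

Lemma normalizable_weak (X Y : L) (f g : term X Y) :
  T (Weak f g) -> normalizable g -> normalizable f.
Proof.
by move=> fg [a na ga]; exists a => //; apply: (th_wtrans T_th fg ga).
Qed.

Lemma normalizable_strong (X Y : L) (f g : term X Y) :
  T (Strong f g) -> normalizable g -> normalizable f.
Proof. by move=> fg; apply/normalizable_weak/(th_weak T_th). Qed.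

Lemma normalizable_pure_comp (X Y Z : L) (w : pterm Y Z) (f : term X Y) :
  normalizable f -> normalizable (pure w \c f).
Proof.
case=> a na fa; exists (pure w \c a); last exact: th_wrepl.
case: na => [u|p]; first by rewrite -pure_comp; constructor.
by rewrite /read Defs.compA -pure_comp; constructor.
Qed.

(** The term [lookup \c (bang Y \c f)] reads the state left by [f]. Result and state go through the
    induction together, since [lookup] turns the state into the result and [update] turns the result
    into the state. *)
Lemma normalizable_result_state (X Y : L) (f : term X Y) :
  normalizable f /\ normalizable (lookup \c (bang Y \c f)).
Proof.
elim: f => [|Y1 Z a f [IHv IHs]].
  split; first by exists (pure (Id X)) => //; [constructor | exact: th_wrefl].
  rewrite compf1; exists (read X (Id \V)); first by constructor.
  exact: th_wrefl.
case: a f IHv IHs => [A B a|g IHv IHs|g IHv _].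
- move=> g IHv IHs; split; first exact: (normalizable_pure_comp (gen a)).
  apply: normalizable_strong IHs; apply: (th_repl T_th).
  rewrite -[Defs.Cons _ g]/(pure (gen a) \c g) Defs.compA; apply: (th_subs T_th).
  exact/bang_comp/accessor_pure.
- have gs : normalizable (lookup \c g).
    apply: normalizable_strong IHs; apply: (th_repl T_th).
    exact/(th_sym T_th)/(bang_comp_unit_source g (accessor_pure (Id \1))).
  split=> //; apply: normalizable_strong gs; apply: (th_repl T_th).
  exact: (@bang_comp_unit_source _ _ g lookup).
- split.
    exists (bang X); last exact: th_wunit.
    exact: NormalPure.
  (* The state after [update \c g] is the result of [g]. *)
  apply: normalizable_weak IHv.
  apply: (th_wtrans T_th _ (weak_lookup_update g)); apply: (th_weak T_th).
  exact/(th_repl T_th)/(bang_comp_unit_source _ (accessor_pure (Id \1))).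
Qed.

Lemma weak_normal_form (X Y : L) (f : term X Y) : normalizable f.
Proof. by case: (normalizable_result_state f). Qed.

Lemma strong_of_weak (X Y : L) (f g : term X Y) :
  T (Weak f g) ->
  T (Weak (lookup \c (bang Y \c f)) (lookup \c (bang Y \c g))) ->
  T (Strong f g).
Proof. by move=> fg fgs; apply/(th_eq2 T_th fg)/(th_eq3 T_th). Qed.

Lemma read_congr (X Y : L) (p q : pterm \V Y) :
  T (Strong (pure p) (pure q)) -> T (Strong (read X p) (read X q)).
Proof. exact: th_subs. Qed.

(** A state that is read and then discarded by [pbang \V] leaves no trace. *)
Lemma read_const (X Y : L) (w : pterm \1 Y) :
  T (Strong (read X (w \c pbang \V)) (pure (w \c pbang X))).
Proof.
rewrite /read !pure_comp -Defs.compA; apply: (th_repl T_th).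
exact: (bang_comp_unit_source (bang X) (v := lookup)).
Qed.

Section Inhabited.
Variables (X Y : L) (k : pterm \1 X).

Lemma read_update (p : pterm \V Y) :
  T (Weak (read X p \c (pure k \c update)) (pure p)).
Proof.
(* The right side becomes [pure p \c Id \V], so that the pure outer term [p] can be peeled off and
   the axiom for [lookup \c update] remains. *)
rewrite /read -!Defs.compA -[X in T (Weak _ X)]compf1; apply: (th_wrepl T_th).
apply: (th_wtrans T_th _ (th_ax T_th)); apply: (th_weak T_th).
by apply/(th_repl T_th)/bang_comp_unit_source/accessor_pure.
Qed.

Lemma weak_read (p q : pterm \V Y) :
  T (Weak (read X p) (read X q)) -> T (Strong (pure p) (pure q)).
Proof.
move=> pq; apply: weak_pure.
apply: (th_wtrans T_th (th_wsym T_th (read_update p))).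
exact: (th_wtrans T_th (th_wsubs T_th _ pq) (read_update q)).
Qed.

(** Precomposing with [pure k \c update] turns the right side into [p] and the left side into a term
    weakly equal to the constant [u \c k], because [update] is weakly [bang \V]. So [p] is constant,
    and then so is [u]. *)
Lemma weak_pure_read (u : pterm X Y) (p : pterm \V Y) :
  T (Weak (pure u) (read X p)) ->
  T (Strong (pure p) (pure (u \c k \c pbang \V))) /\
  T (Strong (pure u) (pure (u \c k \c pbang X))).
Proof.
move=> up; have pc : T (Strong (pure p) (pure (u \c k \c pbang \V))).
  apply: weak_pure; apply: (th_wtrans T_th (th_wsym T_th (read_update p))).
  apply: (th_wtrans T_th (th_wsubs T_th _ (th_wsym T_th up))).
  by rewrite Defs.compA -pure_comp [X in T (Weak _ X)]pure_comp; apply: weak_pure_unit.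
split=> //; apply: weak_pure; apply: (th_wtrans T_th up); apply: (th_weak T_th).
exact: (th_trans T_th (read_congr X pc) (read_const _ _)).
Qed.

End Inhabited.
End Theory.

(** * Reflection of equations into a subtheory with the same pure equations *)

Section Relative_completeness.
Variables (L : pure_logic) (T T' : set (formula L)).
Hypotheses (T_th : theory T) (T'_th : theory T') (TT' : T `<=` T').
Hypothesis T'_pure : forall (X Y : L) (u v : pterm X Y),
  T' (Strong (pure u) (pure v)) -> T (Strong (pure u) (pure v)).
Hypothesis T_source : forall X : L, inhabited_type X \/
  forall (Y : L) (f g : term X Y), T (Strong f g).

(** For an inhabited source, the two constancy equations found in [T'] are pure, hence hold in [T],
    where they suffice to rebuild the weak equation. *)
Lemma weak_pure_read_reflect (X Y : L) (u : pterm X Y) (p : pterm \V Y) :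
  T' (Weak (pure u) (read X p)) -> T (Weak (pure u) (read X p)).
Proof.
case: (T_source X) => [[k]|TX] up; last exact/(th_weak T_th)/TX.
have [/T'_pure pc /T'_pure uc] := weak_pure_read T'_th k up.
apply/(th_weak T_th)/(th_trans T_th uc)/(th_sym T_th).
exact: (th_trans T_th (read_congr T_th X pc) (read_const T_th _ _)).
Qed.

Lemma weak_normal_reflect (X Y : L) (a b : term X Y) :
  normal a -> normal b -> T' (Weak a b) -> T (Weak a b).
Proof.
case=> [u|p] [v|q]; first 2 last.
- by move=> /(th_wsym T'_th) /weak_pure_read_reflect /(th_wsym T_th).
- case: (T_source X) => [[k]|TX] ab; last exact/(th_weak T_th)/TX.
  by apply/(th_weak T_th)/(read_congr T_th)/T'_pure/(weak_read T'_th k ab).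
- by move=> /(weak_pure T'_th) /T'_pure /(th_weak T_th).
- exact: weak_pure_read_reflect.
Qed.

Lemma weak_reflect (X Y : L) (f g : term X Y) : T' (Weak f g) -> T (Weak f g).
Proof.
move=> fg; have [a na fa] := weak_normal_form T_th f.
have [b nb gb] := weak_normal_form T_th g.
apply: (th_wtrans T_th fa); apply: (th_wtrans T_th _ (th_wsym T_th gb)).
apply: weak_normal_reflect => //.
apply: (th_wtrans T'_th (th_wsym T'_th (TT' fa))).
exact: (th_wtrans T'_th fg (TT' gb)).
Qed.

Lemma theory_reflect : T' `<=` T.
Proof.
case=> X Y f g fg; last exact: weak_reflect.
apply: (strong_of_weak T_th); apply/weak_reflect/(th_weak T'_th) => //.
by do 2![apply: (th_repl T'_th)].
Qed.

End Relative_completeness.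

(** * The model built on pure terms *)

Section Model.
Variables (L : pure_logic) (T0 : set (pformula L)).
Hypothesis T0_th : ptheory T0.

(** A state paired with a value, both as generalized elements at stage [A]. No quotient is formed:
    [config_eq] plays the role of equality. *)
Definition config (A X : L) : Type := (pterm A \V * pterm A X)%type.

Definition config_eq (A X : L) (c d : config A X) : Prop :=
  T0 (PEq c.1 d.1) /\ T0 (PEq c.2 d.2).

Definition gen_sem (A X Y : L) (a : sta_gen X Y) : config A X -> config A Y :=
  match a with
  | Pure _ _ w => fun c => (c.1, Defs.Cons w c.2)
  | Lookup => fun c => (c.1, c.1)
  | Update => fun c => (c.2, pbang A)
  end.

Fixpoint sem (A X Y : L) (f : term X Y) (c : config A X) : config A Y :=
  match f with
  | Id => c
  | Defs.Cons _ _ a f' => gen_sem a (sem f' c)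
  end.

Definition valid (e : formula L) : Prop :=
  match e with
  | Strong X _ f g => forall A (c : config A X), config_eq (sem f c) (sem g c)
  | Weak X _ f g =>
      forall A (c : config A X), T0 (PEq (sem f c).2 (sem g c).2)
  end.

Lemma sem_comp (A X Y Z : L) (g : term Y Z) (f : term X Y) (c : config A X) :
  sem (g \c f) c = sem g (sem f c).
Proof. by elim: g f => //= Y1 Z1 a g IH f; rewrite IH. Qed.

Lemma sem_pure (A X Y : L) (u : pterm X Y) (c : config A X) :
  sem (pure u) c = (c.1, u \c c.2).
Proof. by elim: u => [|Y1 Z a u /= ->] //; case: c. Qed.

Lemma sem_accessor (A X Y : L) (f : term X Y) (c : config A X) :
  accessor f -> (sem f c).1 = c.1.
Proof.
rewrite /accessor; elim: f => //= Y1 Z a f IH; rewrite geq_max.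
by case: a f IH => //= [? ? ? f IH /IH|f IH /IH].
Qed.

Lemma gen_sem_congr (A X Y : L) (a : sta_gen X Y) (c d : config A X) :
  config_eq c d -> config_eq (gen_sem a c) (gen_sem a d).
Proof.
case: a c d => [X1 Y1 w| |] c d [cd1 cd2]; split=> //=.
  exact: (pth_repl T0_th (gen w) cd2).
exact: pth_refl.
Qed.

Lemma sem_congr (A X Y : L) (f : term X Y) (c d : config A X) :
  config_eq c d -> config_eq (sem f c) (sem f d).
Proof. by elim: f => //= Y1 Z a f IH /IH; apply: gen_sem_congr. Qed.

Lemma unit_eq (A : L) (f g : pterm A \1) : T0 (PEq f g).
Proof.
apply: (pth_trans T0_th (pth_unit T0_th f)).
exact/(pth_sym T0_th)/(pth_unit T0_th).
Qed.

Lemma valid_pure (k : pterm \1 (\V : L)) :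
  @pure_formula L @^-1` valid = T0.
Proof.
apply/seteqP; split=> -[X Y u v] /=.
  (* The generic value [Id X] at stage [X] recovers the two terms themselves; [k] only supplies some
     state. *)
  by move=> /(_ X (k \c pbang X, Id X))[_]; rewrite !sem_pure /= !compf1.
move=> uv A c; rewrite !sem_pure; split=> /=; first exact: pth_refl.
exact: (pth_subs T0_th).
Qed.

(** For (eq2), [bang] preserves the state; for (eq3), [lookup] copies the state into the result,
    while results in [\1] always agree. The term [k] serves the pure rules, through [valid_pure]. *)
Lemma theory_valid (k : pterm \1 (\V : L)) : theory valid.
Proof.
split=> /=.
- by move=> X Y f A c; split; apply: pth_refl.
- by move=> X Y f g fg A c; have [? ?] := fg A c; split; apply: pth_sym.
- move=> X Y f g h fg gh A c; have [fg1 fg2] := fg A c.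
  have [gh1 gh2] := gh A c.
  by split; [exact: (pth_trans T0_th fg1 gh1)|exact: (pth_trans T0_th fg2 gh2)].
- by move=> X Y Z u v1 v2 v A c; rewrite !sem_comp.
- by move=> X Y Z v1 v2 w v A c; rewrite !sem_comp; apply: sem_congr.
- by move=> X Y f A c; apply: pth_refl.
- by move=> X Y f g fg A c; apply: pth_sym.
- by move=> X Y f g h fg gh A c; apply: (pth_trans T0_th (fg A c) (gh A c)).
- by move=> X Y Z u v1 v2 v A c; rewrite !sem_comp.
- move=> X Y Z v1 v2 w v A c; rewrite !sem_comp !sem_pure /=.
  exact: (pth_repl T0_th).
- by move=> X f A c; apply: unit_eq.
- by move=> X Y f g fg A c; case: (fg A c).
- by move=> A c; apply: pth_refl.
- move=> X Y f g fa ga fg A c; split=> //.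
  by rewrite !sem_accessor //; apply: pth_refl.
- move=> X Y f g fg fgs A c; split=> //.
  by have [] := fgs A c.
- by move=> X f g fg A c; split; [exact: (fg A c)|exact: unit_eq].
- by rewrite valid_pure.
Qed.

End Model.

(** * Generated theories and the completeness theorem *)

Lemma subset_generated (L : pure_logic) (A : set (formula L)) :
  A `<=` generated A.
Proof. exact: sub_smallest. Qed.

Lemma generated_min (L : pure_logic) (A T : set (formula L)) :
  theory T -> A `<=` T -> generated A `<=` T.
Proof. exact: smallest_sub. Qed.

(** Premises in the intersection lie in each theory containing [A], so the conclusion of any rule
    lies in each of them too. *)
Lemma theory_generated (L : pure_logic) (A : set (formula L)) :
  theory (generated A).
Proof.
have ptheory_generated : ptheory (@pure_formula L @^-1` generated A).
  split=> /=.
  - by move=> X Y f B [/th_pure/pth_refl + _]; apply.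
  - by move=> X Y f g fg B BP; apply: (pth_sym (th_pure BP.1)); apply: fg.
  - move=> X Y f g h fg gh B BP.
    by apply: (pth_trans (th_pure BP.1)); [apply: fg | apply: gh].
  - by move=> X Y Z u v w vw B BP; apply: (pth_subs (th_pure BP.1)); apply: vw.
  - by move=> X Y Z v w u vw B BP; apply: (pth_repl (th_pure BP.1)); apply: vw.
  - by move=> X f B [/th_pure/pth_unit + _]; apply.
  - move=> ps c r pps B BP; apply: (pth_extra (th_pure BP.1) r).
    by apply: List.Forall_impl pps => e; apply.
split=> //.
- by move=> X Y f B [/th_refl + _]; apply.
- by move=> X Y f g fg B BP; apply: (th_sym BP.1); apply: fg.
- by move=> X Y f g h fg gh B BP; apply: (th_trans BP.1 (fg B BP) (gh B BP)).
- by move=> X Y Z u v w vw B BP; apply: (th_subs BP.1); apply: vw.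
- by move=> X Y Z v w u vw B BP; apply: (th_repl BP.1); apply: vw.
- by move=> X Y f B [/th_wrefl + _]; apply.
- by move=> X Y f g fg B BP; apply: (th_wsym BP.1); apply: fg.
- by move=> X Y f g h fg gh B BP; apply: (th_wtrans BP.1 (fg B BP) (gh B BP)).
- by move=> X Y Z u v w vw B BP; apply: (th_wsubs BP.1); apply: vw.
- by move=> X Y Z v w u vw B BP; apply: (th_wrepl BP.1); apply: vw.
- by move=> X f B [/th_wunit + _]; apply.
- by move=> X Y f g fg B BP; apply: (th_weak BP.1); apply: fg.
- by move=> B [/th_ax].
- by move=> X Y f g fa ga fg B BP; apply: (th_eq1 BP.1) => //; apply: fg.
- by move=> X Y f g fg fgs B BP; apply: (th_eq2 BP.1 (fg B BP)); apply: fgs.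
- by move=> X f g fg B BP; apply: (th_eq3 BP.1); apply: fg.
Qed.

Theorem theoremA6 (L : pure_logic) (T0 : set (pformula L))
  (T0_theory : ptheory T0) (T0_consistent : pconsistent T0)
  (nonempty_inhabited : forall X : L,
     ~ empty_type (T_sta T0) X -> inhabited_type X)
  (V_nonempty : ~ empty_type (T_sta T0) (\V : L)) :
  hilbert_post_complete (T_sta T0).
Proof.
have [k] := nonempty_inhabited _ V_nonempty.
split.
  (* All of [T_sta T0] is valid in the model, whose valid pure formulas are exactly [T0]; an
     inconsistent [T_sta T0] would thus make [T0] full. *)
  move=> T_all; apply: T0_consistent; rewrite -(valid_pure T0_theory k).
  apply/seteqP; split=> // e _; have : T_sta T0 (pure_formula e).
    by rewrite T_all.
  apply: (generated_min (theory_valid T0_theory k)).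
  by move=> _ [d Td <-]; rewrite -(valid_pure T0_theory k) in Td.
(* The witness consists of all pure equations of [T']. *)
move=> T' T'_th T_T'; exists (@pure_formula L @^-1` T').
split; first exact: th_pure.
apply/seteqP; split; last first.
  apply: generated_min => //; rewrite subUset; split=> //.
  by apply: generated_min => //; apply: image_preimage_subset.
set U := theory_add _ _; have U_th : theory U by apply: theory_generated.
apply: theory_reflect => //.
- apply: generated_min => //; rewrite subUset; split=> //.
  by apply: generated_min => //; apply: image_preimage_subset.
- move=> X Y u v uv; apply: subset_generated; right; apply: subset_generated.
  by exists (PEq u v).
(* An uninhabited [X] is empty for [T_sta T0], so all parallel terms out of [X] are already equal
   there, hence in [U]. *)
- move=> X; case: (pselect (inhabited_type X)) => [|nX]; [by left|right].
  have XT : empty_type (T_sta T0) X.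
    by apply: contrapT => /nonempty_inhabited.
  move=> Y f g; have [i Ti] := XT Y.
  have TU : T_sta T0 `<=` U by move=> e Te; apply: subset_generated; left.
  apply: (th_trans U_th (TU _ (Ti f))).
  exact: (th_sym U_th (TU _ (Ti g))).
Qed.
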